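(* Let $n\ge 1$, $N=\{1,\dots,n\}$, let $A\subsetneq N$ and let $\alpha\in\mathcal{IS}_n$ be the idempotent with $\operatorname{dom}(\alpha)=A$, i.e. the identity map of $A$, where $\operatorname{dom}$ denotes domain. Consider the semigroup $(\mathcal{IS}_n,* )$ with $\beta*\gamma=\beta\alpha\gamma$, and put $\mathcal{C}_A=\{\beta\in\mathcal{IS}_n : \beta(A)=A\}$. Then a nonempty subset $T\subseteq\mathcal{IS}_n$ is a completely isolated subsemigroup of $(\mathcal{IS}_n,* )$ if and only if $T$ is one of $\mathcal{C}_A$, $\mathcal{IS}_n\setminus\mathcal{C}_A$, $\mathcal{IS}_n$.
   Context: $\mathcal{IS}_n$ is the symmetric inverse semigroup of all partial injective transformations of $N=\{1,\dots,n\}$ (including the nowhere defined map), under composition of partial maps. Products are composed from left to right, so $(\beta*\gamma)(x)=\gamma(\alpha(\beta(x)))$ whenever the right-hand side is defined. The condition $\beta(A)=A$ means that $\beta$ is defined on all of $A$ and maps $A$ bijectively onto $A$ (with arbitrary behaviour on $N\setminus A$). A subsemigroup is a nonempty subset closed under the multiplication. A subsemigroup $T$ of a semigroup $S$ is completely isolated if for all $x,y\in S$, $xy\in T$ implies $x\in T$ or $y\in T$; here the multiplication is $*$. *)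

(* Defs.v *)
From HB Require Import structures.
From mathcomp Require Import all_boot all_fingroup.

Set Implicit Arguments.
Unset Strict Implicit.
Unset Printing Implicit Defensive.

Local Open Scope group_scope.

(* [f x = None] means that [f] is undefined at [x]; the points of
   N = {1, ..., n} are represented by 'I_n = {0, ..., n-1}. *)
Definition partial_injective n (f : {ffun 'I_n -> option 'I_n}) : bool :=
  [forall x, forall y, (f x != None) && (f x == f y) ==> (x == y)].

Record IS n := MkIS {
  IS_fun :> {ffun 'I_n -> option 'I_n};
  IS_inj : partial_injective IS_fun
}.

HB.instance Definition _ n := [isSub for @IS_fun n].
HB.instance Definition _ n := [Finite of IS n by <:].

Section SymmetricInverseSemigroup.
Variable n : nat.
Implicit Types f g : IS n.

(* Products are composed from left to right: [f] acts first. *)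
Definition IS_comp_fun f g : {ffun 'I_n -> option 'I_n} :=
  [ffun x => obind g (f x)].

Lemma IS_comp_inj f g : partial_injective (IS_comp_fun f g).
Proof.
apply/forallP=> x; apply/forallP=> y; apply/implyP; rewrite !ffunE.
case Efx: (f x) => [u|] //=; case Efy: (f y) => [v|] /=; last first.
  by case: (g u).
move/forallP/(_ u)/forallP/(_ v)/implyP: (IS_inj g) => /[apply] /eqP Euv.
move/forallP/(_ x)/forallP/(_ y)/implyP: (IS_inj f); apply.
by rewrite Efx Efy Euv eqxx.
Qed.

Definition IS_comp f g : IS n := MkIS (IS_comp_inj f g).

Lemma IS_compA : associative IS_comp.
Proof.
move=> f g h; apply/val_inj/ffunP=> x; rewrite /= !ffunE.
by case: (f x) => //= y; rewrite ffunE.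
Qed.

HB.instance Definition _ := hasMul.Build (IS n) IS_comp.
HB.instance Definition _ := Magma_isSemigroup.Build (IS n) IS_compA.

Definition pdom f : {set 'I_n} := [set x | f x != None].

Definition pimage f (A : {set 'I_n}) : {set 'I_n} :=
  [set y | [exists x in A, f x == Some y]].

Definition CA (A : {set 'I_n}) : {set IS n} :=
  [set f : IS n | (A \subset pdom f) && (pimage f A == A)].

End SymmetricInverseSemigroup.

(* The carrier of [S] with the product [x * a * y]. *)
Definition sandwich (S : semigroupType) (a : S) : Type := S.

Section Sandwich.
Variables (S : semigroupType) (a : S).

HB.instance Definition _ := Choice.on (sandwich a).

Definition sandwich_mul (x y : sandwich a) : sandwich a :=
  (x : S) * a * (y : S).

Lemma sandwich_mulA : associative sandwich_mul.
Proof. by move=> x y z; rewrite /sandwich_mul !mulgA. Qed.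

HB.instance Definition _ := hasMul.Build (sandwich a) sandwich_mul.
HB.instance Definition _ :=
  Magma_isSemigroup.Build (sandwich a) sandwich_mulA.

End Sandwich.

HB.instance Definition _ n (a : IS n) := Finite.copy (sandwich a) (IS n).

Section CompletelyIsolated.
Variables (S : semigroupType) (T : {pred S}).

Definition subsemigroup : Prop := (exists x, x \in T) /\ mulg_closed T.

Definition completely_isolated_subsemigroup : Prop :=
  subsemigroup /\ (forall x y : S, x * y \in T -> x \in T \/ y \in T).

End CompletelyIsolated.

(* Main.v *)
Require Import Defs.
From HB Require Import structures.
From mathcomp Require Import all_boot all_fingroup.

Set Implicit Arguments.
Unset Strict Implicit.
Unset Printing Implicit Defensive.

Local Open Scope group_scope.

(** An idempotent [alpha] with domain [A] is the partial identity [pid A], so the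
    product to study is [f * pid A * g].  A nonempty set [T] is a completely
    isolated subsemigroup exactly when [T] and its complement are both closed
    under this product ([completely_isolatedP]), so the theorem describes the
    partitions of the semigroup into two closed blocks.

    A product stabilises [A] if and only if both of its factors do
    ([CA_sandwich]); hence [CA A] and its complement form such a partition.

    Conversely, every nonempty closed subset of a finite semigroup contains an
    idempotent ([closed_has_idempotent]), and the idempotents here are the
    partial identities of the subsets of [A] ([sandwich_idempotent]).  Among them
    only [pid A] lies in [CA A], so two disjoint closed sets cannot both meet
    [CA A]: it lies in a single block ([CA_one_block]).

    The complement of [CA A] also lies in a single block, that of the empty map
    ([setC_CA_sub]).  Otherwise the other block would contain an idempotent
    outside [CA A], the identity of some proper subset of [A]; but all of these
    are in the block of the empty map.  This last point ([pid_in_block]) is an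
    induction on the size of the subset, which writes the identity of [B] as a
    product of two partial transpositions whose squares are the identity of [B]
    minus a point.

    So each block of a partition into two closed sets is a union of some of the
    two sets [CA A] and its complement. *)

(** * Idempotents in finite semigroups *)

(** Let [U] be a minimal nonempty closed subset of [X] and [x] a point of [U].
    The translate [op x @: U] is closed, so it is [U]; hence the set of the [u]
    in [U] with [op x u = x] is nonempty.  It is closed too, so it is [U] and
    contains [x]. *)
Lemma closed_has_idempotent (S : finType) (op : S -> S -> S) (X : {set S}) :
    associative op -> X != set0 -> {in X &, forall x y, op x y \in X} ->
  exists2 e, e \in X & op e e = e.
Proof.
move=> opA Xn0 Xcl.
pose closed (U : {set S}) :=
  (U != set0) && [forall x in U, forall y in U, op x y \in U].
have closedP (U : {set S}) x0 : x0 \in U -> {in U &, forall x y, op x y \in U} -> closed U.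
  move=> Ux0 Ucl; apply/andP; split; first by apply/set0Pn; exists x0.
  by apply/forall_inP=> x Ux; apply/forall_inP=> y; apply: Ucl.
have [x0 Xx0] := set0Pn _ Xn0.
have [U /minsetP[/andP[/set0Pn[x Ux] /forall_inP Ucl] Umin] sUX] :=
  minset_exists (closedP X x0 Xx0 Xcl).
have {}Ucl : {in U &, forall y z, op y z \in U}.
  by move=> y z Uy; apply: (forall_inP (Ucl y Uy)).
exists x; first exact: (subsetP sUX).
have xU : op x @: U = U.
  apply: Umin; last by apply/subsetP=> _ /imsetP[u Uu ->]; apply: Ucl.
  apply: (closedP _ (op x x)); first exact: imset_f.
  move=> _ _ /imsetP[u Uu ->] /imsetP[v Uv ->].
  by rewrite -opA; apply/imset_f/Ucl => //; apply: Ucl.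
have stabU : [set u in U | op x u == x] = U.
  have: x \in op x @: U by rewrite xU.
  case/imsetP=> u Uu xu; apply: Umin.
    apply: (closedP _ u); first by rewrite inE Uu -xu /=.
    move=> v w; rewrite !inE => /andP[Uv /eqP xv] /andP[Uw /eqP xw].
    by rewrite Ucl // opA xv xw /=.
  by apply/subsetP=> v; rewrite inE => /andP[].
by move: Ux; rewrite -stabU inE => /andP[_ /eqP].
Qed.

(** * Restrictions of permutations *)

Section PartialInjections.
Variable n : nat.
Implicit Types (A B C : {set 'I_n}) (s t : {perm 'I_n}) (f g : IS n).

Lemma IS_eqP f g : f =1 g -> f = g.
Proof. by move=> fg; apply/val_inj/ffunP. Qed.

Lemma IS_mulE f g x : (f * g) x = obind g (f x).
Proof. by rewrite /= ffunE. Qed.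

Lemma IS_injP f x y z : f x = Some z -> f y = Some z -> x = y.
Proof.
move=> fx fy; have /forallP/(_ x)/forallP/(_ y) := IS_inj f.
by rewrite fx fy eqxx => /eqP.
Qed.

Definition restr_fun B s := [ffun x => if x \in B then Some (s x) else None].

Lemma restr_inj B s : partial_injective (restr_fun B s).
Proof.
apply/forallP=> x; apply/forallP=> y; apply/implyP; rewrite !ffunE.
case: ifP => //= _; case: ifP => // _ /eqP[/perm_inj ->]; exact: eqxx.
Qed.

Definition restr B s : IS n := MkIS (restr_inj B s).

Definition pid B := restr B 1.

Lemma restrE B s x : restr B s x = if x \in B then Some (s x) else None.
Proof. by rewrite /= ffunE. Qed.

Lemma restrM B C s t :
  restr B s * restr C t = restr [set x in B | s x \in C] (s * t).
Proof.
apply: IS_eqP => x; rewrite IS_mulE !restrE inE.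
by case: (x \in B) => //=; rewrite restrE permM.
Qed.

Lemma pidE B x : pid B x = if x \in B then Some x else None.
Proof. by rewrite restrE perm1. Qed.

(** By injectivity, a partial injection that fixes its values fixes its domain. *)
Lemma pid_pdom f : (forall x y, f x = Some y -> f y = Some y) -> f = pid (pdom f).
Proof.
move=> fid; apply: IS_eqP => x; rewrite pidE inE.
by case fx: (f x) => [y|] //=; rewrite (IS_injP fx (fid _ _ fx)).
Qed.

(** * The sandwich product over a partial identity *)

Lemma idempotent_pid f : f * f = f -> f = pid (pdom f).
Proof.
by move=> ff; apply: pid_pdom => x y fx; rewrite -fx -{2}ff IS_mulE fx.
Qed.

Lemma sandwich_SomeP A f g x z :
  reflect (exists y, [/\ f x = Some y, y \in A & g y = Some z])
          ((f * pid A * g) x == Some z).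
Proof.
rewrite !IS_mulE; apply: (iffP eqP) => [|[y [-> Ay gy]]]; last first.
  by rewrite /= pidE Ay.
case: (f x) => //= y; rewrite pidE; case: ifP => //= Ay gy.
by exists y.
Qed.

Lemma sandwich_idempotent A f :
  f * pid A * f = f -> f = pid (pdom f) /\ pdom f \subset A.
Proof.
move=> ff.
have fP x y : f x = Some y -> y \in A /\ f y = Some y.
  move=> fx; have /eqP/sandwich_SomeP[z [fz Az fy]] : (f * pid A * f) x = Some y.
    by rewrite ff.
  by move: fz Az fy; rewrite fx => -[<-].
have fE : f = pid (pdom f) by apply: pid_pdom => x y /fP[].
split=> //; apply/subsetP=> x; rewrite inE; case fx: (f x) => [y|] // _.
by have [Ay fy] := fP _ _ fx; rewrite (IS_injP fx fy).
Qed.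

(** Injectivity on the finite set [A] makes surjectivity onto [A] automatic. *)
Lemma mem_CA A f :
  reflect {in A, forall x, exists2 y, y \in A & f x = Some y} (f \in CA A).
Proof.
rewrite inE; apply: (iffP andP) => [[/subsetP Af /eqP fA] x Ax | fA].
  have := Af x Ax; rewrite inE; case fx: (f x) => [y|] // _; exists y => //.
  by rewrite -fA inE; apply/exists_inP; exists x => //; rewrite fx.
split; first by apply/subsetP=> x /fA[y _ fx]; rewrite inE fx.
pose h x := odflt x (f x).
have hE x : x \in A -> f x = Some (h x).
  by rewrite /h => /fA[y _ ->].
have -> : pimage f A = h @: A.
  apply/setP=> y; rewrite inE; apply/exists_inP/imsetP => -[x Ax].
    by rewrite hE // => /eqP[<-]; exists x.
  by move->; exists x => //; rewrite hE.
have hinj : {in A &, injective h}.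
  move=> x y Ax Ay hxy; apply: (IS_injP (hE x Ax)); rewrite hE // hxy //.
rewrite eqEcard card_in_imset // leqnn andbT.
apply/subsetP=> _ /imsetP[x Ax ->]; have [y Ay fx] := fA x Ax.
by rewrite /h fx.
Qed.

(** If the product stabilises [A], its first factor must send [A] into [A], since
    the middle factor [pid A] discards every other value; so [f] permutes [A],
    and then [g] must map [A] into [A] as well. *)
Lemma CA_sandwich A f g :
  (f * pid A * g \in CA A) = (f \in CA A) && (g \in CA A).
Proof.
apply/mem_CA/andP => [fgA | [/mem_CA fA /mem_CA gA] x Ax]; last first.
  have [y Ay fx] := fA x Ax; have [z Az gy] := gA y Ay.
  by exists z => //; apply/eqP/sandwich_SomeP; exists y.
have fgP x : x \in A ->
    exists y z, [/\ f x = Some y, y \in A, z \in A & g y = Some z].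
  move=> /fgA[z Az /eqP/sandwich_SomeP[y [fx Ay gy]]].
  by exists y, z.
have fA : f \in CA A.
  by apply/mem_CA=> x /fgP[y [z [fx Ay _ _]]]; exists y.
split=> //; apply/mem_CA=> y Ay.
have : y \in pimage f A by move: fA; rewrite inE => /andP[_ /eqP->].
rewrite inE => /exists_inP[x /fgP[y' [z [-> _ Az gy']]] /eqP[<-]].
by exists z.
Qed.

Lemma pid_in_CA A B : (pid B \in CA A) = (A \subset B).
Proof.
apply/mem_CA/subsetP => [BA x /BA[y _] | sAB x Ax].
  by rewrite pidE; case: ifP.
by exists x => //; rewrite pidE sAB.
Qed.

(** * Partitions into two closed blocks *)

Definition sandwich_closed A (X : {set IS n}) :=
  {in X &, forall f g, f * pid A * g \in X}.

Lemma sandwich_closed_idempotent A X :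
    X != set0 -> sandwich_closed A X ->
  exists B, [/\ B \subset A & pid B \in X].
Proof.
move=> Xn0 Xcl.
have [|e Xe /sandwich_idempotent[eE sA]] :=
    closed_has_idempotent (op := fun f g => f * pid A * g) _ Xn0 Xcl.
  by move=> f g h; rewrite !mulgA.
by exists (pdom e); rewrite -eE.
Qed.

Lemma sandwich_closedI A X Y :
  sandwich_closed A X -> sandwich_closed A Y -> sandwich_closed A (X :&: Y).
Proof.
move=> Xcl Ycl f g /setIP[Xf Yf] /setIP[Xg Yg].
by rewrite inE Xcl ?Ycl.
Qed.

Lemma CA_closed A : sandwich_closed A (CA A).
Proof. by move=> f g fA gA; rewrite CA_sandwich fA. Qed.

Lemma setC_CA_closed A : sandwich_closed A (~: CA A).
Proof. by move=> f g; rewrite !in_setC CA_sandwich => /negPf->. Qed.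

Lemma pid_mem_closed A X :
  sandwich_closed A X -> X :&: CA A != set0 -> pid A \in X.
Proof.
move=> Xcl XAn0.
have [B [sBA]] :=
  sandwich_closed_idempotent XAn0 (sandwich_closedI Xcl (@CA_closed A)).
rewrite inE pid_in_CA => /andP[XB sAB].
by have /eqP<- : B == A by rewrite eqEsubset sBA.
Qed.

(** Each block that meets [CA A] contains [pid A], the only idempotent of [CA A]. *)
Lemma CA_one_block A X :
    sandwich_closed A X -> sandwich_closed A (~: X) ->
  CA A \subset X \/ CA A \subset ~: X.
Proof.
move=> Xcl X'cl; rewrite -(setCK X) -!disjoints_subset setCK.
have [X0|/(pid_mem_closed Xcl) XA] := eqVneq (X :&: CA A) set0.
  by right; rewrite -setI_eq0 setIC X0.
left; rewrite -setI_eq0 setIC; apply/idPn=> /(pid_mem_closed X'cl).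
by rewrite in_setC XA.
Qed.

Lemma sandwich_restr A B C s t :
    {in B, forall x, s x \in A} ->
  restr B s * pid A * restr C t = restr [set x in B | s x \in C] (s * t).
Proof.
move=> BA; rewrite restrM mulg1; have -> : [set x in B | s x \in A] = B.
  by apply/setP=> x; rewrite inE andb_idr //; apply: BA.
exact: restrM.
Qed.

(** Take [b] in [B] and [a] in [A] outside [B].  Restricted to [B], the
    transposition [t] of [a] and [b] squares to the identity of [B :\ b], because
    [a] is outside [B]; so does its inverse, which is [t] restricted to the image
    of [B].  As [X] and its complement are closed, a map whose square is in [X]
    is in [X], so both maps are in [X] by induction, and their product is the
    identity of [B]. *)
Lemma pid_in_block A X B :
    sandwich_closed A X -> sandwich_closed A (~: X) -> pid set0 \in X ->
  B \proper A -> pid B \in X.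
Proof.
move=> Xcl X'cl X0; have [m] := ubnP #|B|.
elim: m => // m IHm in B *; rewrite ltnS => leBm pBA.
have [-> //|[b Bb]] := set_0Vmem B.
have [sBA [a Aa B'a]] := properP pBA.
have Xb : pid (B :\ b) \in X.
  apply: IHm; last exact: sub_proper_trans (subD1set B b) pBA.
  by apply: leq_trans leBm; rewrite [#|B|](cardsD1 b) Bb.
have sqrtX f : f * pid A * f \in X -> f \in X.
  by apply: contraLR; rewrite -!in_setC => X'f; apply: X'cl.
pose t := tperm a b.
(* [C] is also the image of [B], because [t] is an involution. *)
pose C := t @^-1: B.
have tt : t * t = 1 by apply/permP=> x; rewrite permM tpermK perm1.
have tB x : (t x \in B) = if x == a then true else (x != b) && (x \in B).
  rewrite /t; case: tpermP => [-> | -> | /eqP/negPf-> /eqP/negPf->] //.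
    by rewrite eqxx.
  by rewrite (negPf B'a) eqxx; case: eqP Bb B'a => // -> ->.
have tBA : {in B, forall x, t x \in A}.
  by move=> x Bx; rewrite /t; case: tpermP => // *; apply: (subsetP sBA).
have tCA : {in C, forall x, t x \in A}.
  by move=> x; rewrite inE; apply: (subsetP sBA).
have xa x : x \in B -> x == a = false.
  by case: eqP => // ->; rewrite (negPf B'a).
have -> : pid B = restr B t * pid A * restr C t.
  rewrite sandwich_restr // tt; congr restr; apply/setP=> x.
  by rewrite !inE tpermK andbb.
have BtB x : (x \in B) && (t x \in B) = (x \in B :\ b).
  rewrite in_setD1 tB; case Bx: (x \in B); rewrite ?andbF //= xa // andbT.
apply: Xcl; apply: sqrtX; rewrite sandwich_restr // tt.
  suff -> : [set x in B | t x \in B] = B :\ b by [].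
  by apply/setP=> x; rewrite inE BtB.
suff -> : [set x in C | t x \in C] = B :\ b by [].
by apply/setP=> x; rewrite -BtB !inE tpermK andbC.
Qed.

Lemma setC_CA_sub A X :
    sandwich_closed A X -> sandwich_closed A (~: X) -> pid set0 \in X ->
  ~: CA A \subset X.
Proof.
move=> Xcl X'cl X0; rewrite -[X]setCK -disjoints_subset -setI_eq0 setIC.
apply/idPn=> Yn0.
have [B [sBA]] :=
  sandwich_closed_idempotent Yn0 (sandwich_closedI X'cl (@setC_CA_closed A)).
rewrite !in_setI !in_setC pid_in_CA => /andP[/negP X'B sAB]; apply: X'B.
by apply: (pid_in_block Xcl) => //; rewrite properE sBA.
Qed.

End PartialInjections.

(** * Completely isolated subsemigroups *)

(** Complete isolation is the contrapositive of closure of the complement. *)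
Lemma completely_isolatedP n (A : {set 'I_n}) (T : {set sandwich (pid A)}) :
    T != set0 ->
  completely_isolated_subsemigroup T <->
  sandwich_closed A T /\ sandwich_closed A (~: T).
Proof.
move=> /set0Pn Tn0; split=> [[[_ Tcl] Tiso] | [Tcl T'cl]].
  split; first exact: Tcl.
  move=> f g; rewrite !in_setC => /negP T'f /negP T'g; apply/negP.
  by case/Tiso.
split=> // f g Tfg; apply/orP; move: Tfg; apply: contraLR.
by rewrite negb_or -!in_setC => /andP[]; apply: T'cl.
Qed.

Theorem theorem4 (n : nat) (hn : (1 <= n)%N)
    (A : {set 'I_n}) (hA : A \proper [set: 'I_n])
    (alpha : IS n) (alpha_idem : alpha * alpha = alpha)
    (dom_alpha : pdom alpha = A)
    (T : {set sandwich alpha}) (hT : T != set0) :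
  completely_isolated_subsemigroup T <->
  [\/ T = CA A, T = ~: CA A | T = [set: IS n]].
Proof.
have := idempotent_pid alpha_idem; rewrite dom_alpha => alphaE.
move: T hT; rewrite {}alphaE => T hT.
apply: iff_trans (completely_isolatedP hT) _; split=> [[Tcl T'cl] | ]; last first.
  case=> ->; rewrite ?setCK.
  - by split; [apply: CA_closed | apply: setC_CA_closed].
  - by split; [apply: setC_CA_closed | apply: CA_closed].
  by split=> f g; rewrite !inE.
have [T0 | T'0] := boolP (pid set0 \in (T : {set IS n})).
  have sCT := setC_CA_sub Tcl T'cl T0.
  case: (CA_one_block Tcl T'cl) => sC.
    apply: Or33; apply/eqP; rewrite eqEsubset subsetT /=.
    by rewrite -(setUCr (CA A)) subUset sC.
  by apply: Or32; apply/eqP; rewrite eqEsubset sCT -setCS setCK sC.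
have sTC : (T : {set IS n}) \subset CA A.
  rewrite -setCS; apply: setC_CA_sub; rewrite ?setCK ?in_setC //.
case: (CA_one_block Tcl T'cl) => sC.
  by apply: Or31; apply/eqP; rewrite eqEsubset sTC.
case/negP: hT; rewrite -subset0 -(setICr (T : {set IS n})) subsetI subxx.
exact: subset_trans sC.
Qed.
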